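(* Let $g$ be the function defined in the context below. Then, for $1/4 \le \theta \le 1/2$: (i) $g(1/4) \le 5/8$; (ii) $g(\theta) \le 9/16$ for $5/16 \le \theta \le 1/2$; (iii) $g(\theta) \le 17/32$ for $5/16 \le \theta \le 1/2$; (iv) $g(\theta) \le 1/2$ for $1/3 < \theta \le 1/2$; (v) $g(\theta) \le 1/2$ for $743/2306 < \theta \le 1/2$.
   Context: For $0 \le \theta \le 1/2$ and $C > 0$, a positive integer $n$ is called a $(\theta, C)$-almost square of type $2$ if $n = a_1 b_1 = a_2 b_2$ for some integers $a_1 < a_2 \le b_2 < b_1$ all lying in the interval $[n^{1/2} - C n^{\theta}, n^{1/2} + C n^{\theta}]$. Given $0 \le \theta \le 1/2$, call a real number $\phi \ge 0$ admissible (for $\theta$) if there exist constants $C_\theta, D_\theta > 0$ such that for all sufficiently large real $x$ the interval $[x - D_\theta x^{\phi}, x + D_\theta x^{\phi}]$ contains a $(\theta, C_\theta)$-almost square of type $2$. Define $g(\theta)$ as the infimum of all admissible $\phi$; a bound $g(\theta) \le \beta$ means in particular that admissible $\phi$ exist and their infimum is at most $\beta$. *)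

(* Defs.v *)
From Stdlib Require Import Reals ZArith.
From Coquelicot Require Import Coquelicot.
Open Scope R_scope.

Definition near_sqrt (theta C : R) (n a : Z) : Prop :=
  sqrt (IZR n) - C * Rpower (IZR n) theta <= IZR a
    <= sqrt (IZR n) + C * Rpower (IZR n) theta.

(* The factors are integers, not assumed positive: the interval may reach
   below 0 when theta = 1/2 and for small n. *)
Definition almost_square2 (theta C : R) (n : Z) : Prop :=
  (0 < n)%Z /\
  exists a1 b1 a2 b2 : Z,
    n = (a1 * b1)%Z /\ n = (a2 * b2)%Z /\
    (a1 < a2)%Z /\ (a2 <= b2)%Z /\ (b2 < b1)%Z /\
    near_sqrt theta C n a1 /\ near_sqrt theta C n b1 /\
    near_sqrt theta C n a2 /\ near_sqrt theta C n b2.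

(* [Rpower] is the real power only on positive bases; since [x0] may be
   chosen positive, its values at [x <= 0] are irrelevant. *)
Definition admissible (theta phi : R) : Prop :=
  0 <= phi /\
  exists C D : R, 0 < C /\ 0 < D /\
  exists x0 : R, forall x : R, x0 <= x ->
  exists n : Z, almost_square2 theta C n /\
    x - D * Rpower x phi <= IZR n <= x + D * Rpower x phi.

(* The infimum of the empty set is [p_infty], so [Rbar_le (g theta) beta] with
   [beta] real includes the existence of an admissible exponent. *)
Definition g (theta : R) : Rbar := Glb_Rbar (admissible theta).

(* Main.v *)
Require Import Defs.
From Stdlib Require Import Reals ZArith Lra Lia Psatz.
From Coquelicot Require Import Coquelicot.
Open Scope R_scope.

(** Every number n = (E^2 - i^2)(D^2 - j^2) factors as ((E-i)(D-j))((E+i)(D+j))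
    and as ((E-i)(D+j))((E+i)(D-j)), and all four factors lie within 2(Ej + Di)
    of sqrt n.  So one looks for E, D, i, j with n close to x and Ej + Di small.

    For (i) and (iii), E and D are S + T and S - T with S^2 - T^2 slightly above
    sqrt x.  With i = j = 1 this gives 5/8; choosing i and then j greedily so
    as to absorb the excess (ED)^2 - x gives 17/32, which also implies (ii).

    For (iv) and (v) the exponent 1/2 is obtained already at
    theta = 7/22 < 743/2306, without exponential sums.  Write x = W^22, y = W^11,
    let q be a power of 3 of size W, and take E0 slightly above (q y)^(1/3).
    There q y/E0^3 is nearly 1, and E0 can be chosen with q y/E0^2 very close to an
    integer a; hence q y/(E0 + t) = q y/E0 - a t + t^2 + O(1) for 0 <= t < q.
    Among three consecutive g one makes t^2 - a t + g = 0 solvable modulo q = 3^k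
    (Hensel), so some E = E0 + t has an integer D with D - y/E positive and of
    size 1/q.  With i = 1 one greedy choice of j finishes. *)

(** * Monotonicity in [theta], and admissible exponents as bounds on [g] *)

Lemma Rpower_le_base (a b z : R) : 0 < a <= b -> 0 <= z -> Rpower a z <= Rpower b z.
Proof. intros Hab Hz. apply Rle_Rpower_l; lra. Qed.

Lemma almost_square2_mono (theta theta' C : R) (n : Z) :
  theta <= theta' -> 0 < C -> almost_square2 theta C n -> almost_square2 theta' C n.
Proof.
  intros Ht HC [Hn (a1 & b1 & a2 & b2 & E1 & E2 & H1 & H2 & H3 & N1 & N2 & N3 & N4)].
  assert (Hn1 : 1 <= IZR n) by (apply IZR_le; lia).
  assert (HP : C * Rpower (IZR n) theta <= C * Rpower (IZR n) theta').
  { apply Rmult_le_compat_l; [lra|].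
    destruct (Req_dec (IZR n) 1) as [->|Hne].
    - unfold Rpower. rewrite ln_1, !Rmult_0_r. lra.
    - apply Rle_Rpower; lra. }
  split; [exact Hn|].
  exists a1, b1, a2, b2.
  unfold near_sqrt in *.
  repeat (split; [assumption || lra|]); lra.
Qed.

Lemma admissible_mono (theta theta' phi : R) :
  theta <= theta' -> admissible theta phi -> admissible theta' phi.
Proof.
  intros Ht [Hphi (C & D & HC & HD & x0 & H)].
  split; [exact Hphi|].
  exists C, D; repeat split; try assumption.
  exists x0; intros x Hx.
  destruct (H x Hx) as (n & Hn & Hb).
  exists n; split; [|exact Hb].
  now apply almost_square2_mono with theta.
Qed.

Lemma g_le (theta phi : R) : admissible theta phi -> Rbar_le (g theta) (Finite phi).
Proof. intros H. exact (proj1 (Glb_Rbar_correct (admissible theta)) phi H). Qed.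

(** * Almost squares from quadruples [E], [D], [i], [j] *)

Lemma almost_square2_quadruple (theta C : R) (E D i j : Z) :
  (0 < i < E)%Z -> (0 < j < D)%Z ->
  2 * IZR (E * j + D * i) <= C * Rpower (IZR ((E * E - i * i) * (D * D - j * j))) theta ->
  almost_square2 theta C ((E * E - i * i) * (D * D - j * j)).
Proof.
  intros Hi Hj HC.
  set (n := ((E * E - i * i) * (D * D - j * j))%Z) in *.
  set (lo := ((E - i) * (D - j))%Z).
  set (hi := ((E + i) * (D + j))%Z).
  assert (Hlo : (0 < lo)%Z) by (unfold lo; nia).
  assert (Hlh : (lo < hi)%Z) by (unfold lo, hi; nia).
  assert (Hn : n = (lo * hi)%Z) by (unfold n, lo, hi; ring).
  (* [lo * hi = n] puts [sqrt n] in [[lo, hi]], hence within [hi - lo] of every point there. *)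
  assert (Hnear : forall a : Z, (lo <= a <= hi)%Z -> near_sqrt theta C n a).
  { intros a Ha.
    assert (Hsp : IZR hi - IZR lo = 2 * IZR (E * j + D * i)).
    { rewrite <- minus_IZR, <- mult_IZR. f_equal. unfold lo, hi. ring. }
    assert (L1 : 0 < IZR lo) by (apply IZR_lt; lia).
    assert (L2 : IZR lo < IZR hi) by (apply IZR_lt; lia).
    assert (L3 : IZR lo <= IZR a <= IZR hi) by (split; apply IZR_le; lia).
    assert (L4 : IZR n = IZR lo * IZR hi) by (rewrite Hn; apply mult_IZR).
    assert (S1 : IZR lo <= sqrt (IZR n)).
    { rewrite <- (sqrt_square (IZR lo)) by lra. apply sqrt_le_1; nra. }
    assert (S2 : sqrt (IZR n) <= IZR hi).
    { rewrite <- (sqrt_square (IZR hi)) by lra. apply sqrt_le_1; nra. }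
    unfold near_sqrt; lra. }
  split; [rewrite Hn; nia|].
  assert (M1 : (lo < (E - i) * (D + j) < hi)%Z) by (unfold lo, hi; nia).
  assert (M2 : (lo < (E + i) * (D - j) < hi)%Z) by (unfold lo, hi; nia).
  (* The mixed products come in this order exactly when [E j <= D i]; equality gives [a2 = b2],
     which is allowed. *)
  destruct (Z_le_gt_dec ((E - i) * (D + j)) ((E + i) * (D - j))) as [Hle|Hgt].
  - exists lo, hi, ((E - i) * (D + j))%Z, ((E + i) * (D - j))%Z.
    repeat (split; [first [exact Hn | unfold n; ring | lia | apply Hnear; lia] |]).
    apply Hnear; lia.
  - exists lo, hi, ((E + i) * (D - j))%Z, ((E - i) * (D + j))%Z.
    repeat (split; [first [exact Hn | unfold n; ring | lia | apply Hnear; lia] |]).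
    apply Hnear; lia.
Qed.

Lemma Rpower_root_pow (x : R) (k p : nat) :
  0 < x -> (0 < k)%nat -> Rpower x (/ INR k) ^ p = Rpower x (INR p / INR k).
Proof.
  intros Hx Hk.
  rewrite <- Rpower_pow by apply exp_pos.
  rewrite Rpower_mult. f_equal. unfold Rdiv. ring.
Qed.

(** Writing [x = W ^ k] turns the real powers of [x] into natural powers of [W], so that size
    estimates become polynomial in [W]. *)
Lemma admissible_of_quadruples (k p m : nat) (K W0 : R) :
  (p <= k)%nat -> (m < k)%nat -> 0 < K ->
  (forall W : R, W0 <= W -> exists E D i j : Z,
      (0 < i < E)%Z /\ (0 < j < D)%Z /\
      Rabs (IZR ((E * E - i * i) * (D * D - j * j)) - W ^ k) <= K * W ^ m /\
      IZR (E * j + D * i) <= K * W ^ p) ->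
  admissible (INR p / INR k) (INR m / INR k).
Proof.
  intros Hpk Hmk HK H.
  assert (Hk : 0 < INR k) by (apply lt_0_INR; lia).
  assert (Hp0 : 0 <= INR p / INR k).
  { apply Rmult_le_pos; [apply pos_INR | left; apply Rinv_0_lt_compat; lra]. }
  assert (Hp1 : INR p / INR k <= 1).
  { apply (Rmult_le_reg_r (INR k)); [lra|]. unfold Rdiv.
    rewrite Rmult_assoc, Rinv_l, Rmult_1_r, Rmult_1_l by lra. apply le_INR; lia. }
  split.
  { apply Rmult_le_pos; [apply pos_INR | left; apply Rinv_0_lt_compat; lra]. }
  (* One factor 2 comes from the width [2 (E j + D i)]; the other pays for replacing [x] by
     [n >= x / 2], as [p / k <= 1]. *)
  exists (4 * K), K. split; [lra|]. split; [lra|].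
  (* For [W >= B] and [m < k] one gets [K * W ^ m <= W ^ k / 2], whence [n >= x / 2]. *)
  set (B := Rmax 1 (Rmax W0 (2 * K))).
  assert (HB1 : 1 <= B) by apply Rmax_l.
  assert (HB2 : W0 <= B).
  { eapply Rle_trans; [|apply Rmax_r]. apply Rmax_l. }
  assert (HB3 : 2 * K <= B).
  { eapply Rle_trans; [|apply Rmax_r]. apply Rmax_r. }
  exists (B ^ k). intros x Hx.
  assert (HBk : 0 < B ^ k) by (apply pow_lt; lra).
  set (W := Rpower x (/ INR k)).
  assert (HWk : W ^ k = x).
  { unfold W. rewrite Rpower_root_pow by (lra || lia).
    unfold Rdiv. rewrite Rinv_r by lra. apply Rpower_1; lra. }
  assert (HBW : B <= W).
  { apply Rle_trans with (Rpower (B ^ k) (/ INR k)).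
    - rewrite <- Rpower_pow by lra. rewrite Rpower_mult, Rinv_r, Rpower_1; lra.
    - apply Rpower_le_base; [lra|]. left; apply Rinv_0_lt_compat; lra. }
  destruct (H W ltac:(lra)) as (E & D & i & j & Hi & Hj & Hn & Hs).
  set (n := ((E * E - i * i) * (D * D - j * j))%Z) in *.
  assert (Hm : K * W ^ m <= x / 2).
  { rewrite <- HWk. replace k with (S m + (k - S m))%nat by lia.
    rewrite pow_add. simpl pow.
    assert (1 <= W ^ (k - S m)) by (apply pow_R1_Rle; lra).
    assert (0 < W ^ m) by (apply pow_lt; lra).
    assert (K * W ^ m <= W * W ^ m / 2) by nra.
    assert (0 <= W * W ^ m) by nra.
    nra. }
  exists n. unfold W in Hn at 2.
  rewrite Rpower_root_pow in Hn by (lra || lia). rewrite HWk in Hn.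
  pose proof (proj1 (Rabs_le_between _ _) Hn) as Hn'.
  unfold W in Hm. rewrite Rpower_root_pow in Hm by (lra || lia).
  split; [|lra].
  apply almost_square2_quadruple; [assumption|assumption|].
  fold n. unfold W in Hs. rewrite Rpower_root_pow in Hs by (lra || lia).
  assert (H2n : Rpower x (INR p / INR k) <= 2 * Rpower (IZR n) (INR p / INR k)).
  { apply Rle_trans with (Rpower (2 * IZR n) (INR p / INR k)).
    - apply Rpower_le_base; lra.
    - rewrite <- Rpower_mult_distr by lra.
      apply Rmult_le_compat_r; [left; apply exp_pos|].
      rewrite <- (Rpower_1 2) at 2 by lra.
      apply Rle_Rpower; lra. }
  nra.
Qed.

(** * Greedy squares, and products just above a fourth power *)

(** The greedy choice: removing the largest square from [r] leaves less than [2 i + 1], of order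
    [sqrt r]. *)
Lemma floor_sqrt (r : R) : 1 <= r ->
  exists i : Z, (1 <= i)%Z /\ IZR i * IZR i <= r < (IZR i + 1) * (IZR i + 1).
Proof.
  intros Hr.
  destruct (archimed (sqrt r)) as [A1 A2].
  assert (S1 : 1 <= sqrt r) by (rewrite <- sqrt_1; apply sqrt_le_1; lra).
  assert (S2 : sqrt r * sqrt r = r) by (apply sqrt_sqrt; lra).
  assert (U : (1 < up (sqrt r))%Z) by (apply lt_IZR; lra).
  exists (up (sqrt r) - 1)%Z. split; [lia|].
  rewrite minus_IZR. nra.
Qed.

(** Here [E D = S^2 - (t - 2)^2] with [S] just above [u^2], and the square absorbs most of
    [S^2 - u^4]. The lower bound 10 leaves an excess for [i] and [j] to absorb. *)
Lemma product_near_fourth_power (u : R) : 100 <= u ->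
  exists E D : Z,
    9/10 * u ^ 2 <= IZR E <= 11/10 * u ^ 2 /\ 9/10 * u ^ 2 <= IZR D <= 11/10 * u ^ 2 /\
    10 <= IZR E * IZR D - u ^ 4 <= 18 * u.
Proof.
  intros Hu.
  destruct (archimed (u ^ 2)) as [A1 A2].
  (* The extra 1 forces [S^2 - u^4 >= 2 u^2], hence [t >= 4] below. *)
  set (S := (up (u ^ 2) + 1)%Z).
  assert (HS : u ^ 2 + 1 <= IZR S <= u ^ 2 + 2) by (unfold S; rewrite plus_IZR; lra).
  assert (HX : 100 * u <= u ^ 2) by nra.
  assert (Hr1 : 16 <= IZR S * IZR S - u ^ 4) by nra.
  assert (Hr2 : IZR S * IZR S - u ^ 4 <= 5 * u ^ 2) by nra.
  destruct (floor_sqrt (IZR S * IZR S - u ^ 4)) as (t & Ht & Ht1 & Ht2); [lra|].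
  assert (Hr : 3 < IZR t < 3 * u) by (split; nra).
  assert (H4 : 4 <= IZR t) by (apply IZR_le; assert (3 < t)%Z by (apply lt_IZR; lra); lia).
  (* With [t] itself the excess could vanish; with [t - 2] it lies between [4 t - 4 >= 12] and
     [6 t - 3 < 18 u]. *)
  exists (S + (t - 2))%Z, (S - (t - 2))%Z.
  rewrite plus_IZR, !minus_IZR.
  repeat split; nra.
Qed.

(** * Quadratic congruences modulo powers of 3 *)

(** Already modulo 3 some shift [s] gives a root where the derivative is a unit; that same [s] then
    serves for every power of 3. *)
Lemma quadratic_root_mod_3pow (a g : Z) (k : nat) :
  exists s t : Z, (0 <= s <= 2)%Z /\ (0 <= t < 3 ^ Z.of_nat k)%Z /\
    (3 ^ Z.of_nat k | t * t - a * t + g + s)%Z.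
Proof.
  assert (Base : exists s t : Z, (0 <= s <= 2)%Z /\
            (3 | t * t - a * t + g + s)%Z /\ ((2 * t - a) mod 3 <> 0)%Z).
  { pose proof (Z.mod_pos_bound a 3 ltac:(lia)).
    pose proof (Z.mod_pos_bound g 3 ltac:(lia)).
    pose proof (Z_div_mod_eq_full a 3). pose proof (Z_div_mod_eq_full g 3).
    set (a' := (a / 3)%Z) in *. set (g' := (g / 3)%Z) in *.
    (* [2 t - a] is nonzero modulo 3 for [t = 1] if 3 divides [a], and for [t = 0] otherwise; [s]
       then cancels the value of the quadratic at [t]. *)
    set (t := (if a mod 3 =? 0 then 1 else 0)%Z).
    set (s := ((if a mod 3 =? 0 then 2 else 0) - g mod 3)%Z).
    exists (s mod 3)%Z, t.
    pose proof (Z.mod_pos_bound s 3 ltac:(lia)).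
    pose proof (Z_div_mod_eq_full s 3).
    split; [lia|].
    destruct (Z.eqb_spec (a mod 3) 0) as [Ha|Ha]; subst t s.
    - split.
      + exists (1 - a' + g' - (2 - g mod 3) / 3)%Z. lia.
      + intro Hm. apply Z.mod_divide in Hm; [|lia]. destruct Hm as [c Hc]. lia.
    - split.
      + exists (g' - (0 - g mod 3) / 3)%Z. lia.
      + intro Hm. apply Z.mod_divide in Hm; [|lia]. destruct Hm as [c Hc]. lia. }
  destruct Base as (s & t0 & Hs & Ht0 & Hd0).
  exists s.
  (* Hensel lifting: the derivative [2 t - a] stays invertible modulo 3. *)
  assert (Lift : exists t : Z, (3 ^ Z.of_nat k | t * t - a * t + g + s)%Z /\
                   ((2 * t - a) mod 3 <> 0)%Z).
  { induction k as [|k (t & [c Hc] & Hd)].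
    - exists t0. split; [exists (t0 * t0 - a * t0 + g + s)%Z; simpl; lia|exact Hd0].
    - replace (Z.of_nat (S k)) with (Z.of_nat k + 1)%Z by lia.
      rewrite Z.pow_add_r by lia. change (3 ^ 1)%Z with 3%Z.
      (* From modulus 1 to 3 the base root serves again; the Newton step uses that 3 divides [P], so
         that [3 P] divides [P^2]. *)
      destruct k as [|k].
      + exists t0. split; [exact Ht0 | exact Hd0].
      + set (d := (2 * t - a)%Z) in *.
        set (P := (3 ^ Z.of_nat (S k))%Z) in *.
        assert (HP : P = (3 * 3 ^ Z.of_nat k)%Z).
        { unfold P. rewrite Nat2Z.inj_succ, Z.pow_succ_r; lia. }
        set (Q := (3 ^ Z.of_nat k)%Z) in *.
        assert (Hdd : exists e, (d * d = 3 * e + 1)%Z).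
        { pose proof (Z.mod_pos_bound d 3 ltac:(lia)).
          pose proof (Z_div_mod_eq_full d 3) as Hq.
          set (b := (d / 3)%Z) in *.
          assert (Hcase : (d = 3 * b + 1 \/ d = 3 * b + 2)%Z) by lia.
          destruct Hcase as [Hb | Hb].
          - exists (3 * b * b + 2 * b)%Z. rewrite Hb. ring.
          - exists (3 * b * b + 4 * b + 1)%Z. rewrite Hb. ring. }
        destruct Hdd as [e He].
        (* Newton's step from the value [c P]: since [d * d] is 1 modulo 3, the derivative [d] is
           its own inverse. *)
        exists (t - P * (c * d))%Z. split.
        * exists (- c * e + Q * (c * d) * (c * d))%Z.
          transitivity ((t * t - a * t + g + s) - P * c * (d * d)
                        + P * P * (c * d) * (c * d))%Z.
          { unfold d. ring. }
          rewrite Hc, He, HP. ring.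
        * intro Hm. apply Hd.
          apply Z.mod_divide in Hm; [|lia]. destruct Hm as [f Hf].
          apply Z.mod_divide; [lia|].
          exists (f + 2 * Q * (c * d))%Z. unfold d in *. rewrite HP in Hf. lia. }
  destruct Lift as (t & [c Hc] & _).
  set (q := (3 ^ Z.of_nat k)%Z) in *.
  assert (Hq : (0 < q)%Z) by (apply Z.pow_pos_nonneg; lia).
  exists (t mod q)%Z.
  split; [lia|]. split; [apply Z.mod_pos_bound; lia|].
  pose proof (Z_div_mod_eq_full t q) as Ht.
  set (r := (t mod q)%Z) in *. set (b := (t / q)%Z) in *.
  exists (c - 2 * b * r - q * b * b + a * b)%Z.
  replace (r * r - a * r + g + s)%Z with
    ((t * t - a * t + g + s) - q * (2 * b * r + q * b * b - a * b))%Z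
    by (rewrite Ht; ring).
  rewrite Hc. ring.
Qed.

(** * Integers [E] for which [y / E] lies just below an integer *)

Lemma discrete_ivt (f : nat -> R) (c : R) (N : nat) :
  f 0%nat < c -> c <= f N -> exists n : nat, (n < N)%nat /\ f n < c <= f (S n).
Proof.
  intros H0. induction N as [|N IH]; intros HN; [lra|].
  destruct (Rlt_dec (f N) c) as [Hlt|Hge].
  - exists N. split; [lia|lra].
  - destruct IH as (n & Hn & Hf); [lra|]. exists n. split; [lia|exact Hf].
Qed.

(** At integers, [h e = s^6 / e^2 + 2 e] differs from the slope by an integer, and its derivative
    vanishes at [e = s^2]. Over a window of length about [s] beyond that point its unit steps
    increase it by at most [7 / s], yet in total it grows by at least 1, so it crosses an integer
    with error at most [7 / s]. *)
Lemma flat_point_with_integral_slope (s : R) : 100 <= s ->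
  exists E a : Z, s ^ 2 <= IZR E <= s ^ 2 + s + 2 /\
    Rabs (s ^ 6 / (IZR E * IZR E) - IZR a) <= 7 / s.
Proof.
  intros Hs.
  destruct (archimed (s ^ 2)) as [A1 A2].
  set (E0 := up (s ^ 2)) in *.
  assert (Hs2 : 100 * s <= s ^ 2) by nra.
  set (h := fun e : R => s ^ 6 / (e * e) + 2 * e).
  (* With [e = s^2 + v]: the excess of [h] over its minimum [3 s^2], attained at [s^2]. *)
  assert (Hexc : forall v, 0 <= v ->
            h (s ^ 2 + v) = 3 * s ^ 2 + v * v * (3 * s ^ 2 + 2 * v) / ((s ^ 2 + v) * (s ^ 2 + v))).
  { intros v Hv. unfold h. field. nra. }
  (* With [e + 1 = s^2 + w], the step is at most [2 - 2 s^6 / (e + 1)^3 <= 6 w / s^2], and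
     [w <= s + 2]. *)
  assert (Hinc : forall e, s ^ 2 <= e -> e + 1 <= s ^ 2 + s + 2 -> h (e + 1) - h e <= 7 / s).
  { intros e He1 He2.
    assert (He : 0 < e) by lra.
    assert (Hid : 7 / s - (h (e + 1) - h e) =
              (7 - 2 * s) / s + s ^ 6 * (2 * e + 1) / (e * e * ((e + 1) * (e + 1)))).
    { unfold h. field. lra. }
    assert (Hlb : 2 * s ^ 6 / ((e + 1) * (e + 1) * (e + 1)) <=
              s ^ 6 * (2 * e + 1) / (e * e * ((e + 1) * (e + 1)))).
    { assert (Hd : s ^ 6 * (2 * e + 1) / (e * e * ((e + 1) * (e + 1)))
                - 2 * s ^ 6 / ((e + 1) * (e + 1) * (e + 1)) =
              s ^ 6 * (3 * e + 1) / (e * e * ((e + 1) * (e + 1) * (e + 1)))).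
      { field. lra. }
      assert (0 <= s ^ 6 * (3 * e + 1) / (e * e * ((e + 1) * (e + 1) * (e + 1)))); [|lra].
      apply Rdiv_le_0_compat.
      - apply Rmult_le_pos; [apply pow_le|]; lra.
      - repeat apply Rmult_lt_0_compat; lra. }
    assert (Hb : (2 * s - 7) / s <= 2 * s ^ 6 / ((e + 1) * (e + 1) * (e + 1))).
    { set (w := e + 1 - s ^ 2).
      assert (Hw : 0 <= w <= s + 2) by (unfold w; lra).
      replace (e + 1) with (s ^ 2 + w) by (unfold w; ring).
      assert (Hz : 0 < s ^ 2 + w) by lra.
      assert (Hz3 : 0 < (s ^ 2 + w) * (s ^ 2 + w) * (s ^ 2 + w))
        by (repeat apply Rmult_lt_0_compat; lra).
      assert (H1 : 2 * (1 - 3 * w / s ^ 2) <=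
                2 * s ^ 6 / ((s ^ 2 + w) * (s ^ 2 + w) * (s ^ 2 + w))).
      { assert (Hd : 2 * s ^ 6 / ((s ^ 2 + w) * (s ^ 2 + w) * (s ^ 2 + w))
                    - 2 * (1 - 3 * w / s ^ 2) =
                  2 * (w * w * (6 * s ^ 4 + 8 * s ^ 2 * w + 3 * w * w)) /
                  (s ^ 2 * ((s ^ 2 + w) * (s ^ 2 + w) * (s ^ 2 + w)))).
        { field. lra. }
        assert (0 <= 2 * (w * w * (6 * s ^ 4 + 8 * s ^ 2 * w + 3 * w * w)) /
                  (s ^ 2 * ((s ^ 2 + w) * (s ^ 2 + w) * (s ^ 2 + w)))); [|lra].
        assert (0 <= s ^ 4) by (apply pow_le; lra).
        apply Rdiv_le_0_compat; [|apply Rmult_lt_0_compat; lra].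
        assert (0 <= s ^ 2 * w) by (apply Rmult_le_pos; lra).
        assert (0 <= w * w) by nra.
        apply Rmult_le_pos; [lra|]. apply Rmult_le_pos; lra. }
      eapply Rle_trans; [|exact H1].
      assert (Hd : 2 * (1 - 3 * w / s ^ 2) - (2 * s - 7) / s = (7 * s - 6 * w) / s ^ 2)
        by (field; lra).
      assert (0 <= (7 * s - 6 * w) / s ^ 2) by (apply Rdiv_le_0_compat; lra).
      lra. }
    replace ((7 - 2 * s) / s) with (- ((2 * s - 7) / s)) in Hid by (field; lra).
    lra. }
  destruct (archimed s) as [B1 B2].
  set (N := Z.to_nat (up s)).
  assert (HN : INR N = IZR (up s)).
  { unfold N. rewrite INR_IZR_INZ, Z2Nat.id; [reflexivity|].
    apply le_IZR. lra. }
  set (f := fun n : nat => h (IZR E0 + INR n)).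
  (* The excess of [h] over [3 s^2] is about [3 v^2 / s^2]: at most 1 at the start, where [v <= 1],
     and at least 2 at the end, where [v >= s]. The integer [c] lies between. *)
  destruct (archimed (f 0%nat)) as [C1 C2].
  set (c := up (f 0%nat)) in *.
  assert (Hf0 : f 0%nat <= 3 * s ^ 2 + 1).
  { unfold f. simpl INR. rewrite Rplus_0_r.
    set (v := IZR E0 - s ^ 2).
    assert (Hv : 0 <= v <= 1) by (unfold v; lra).
    replace (IZR E0) with (s ^ 2 + v) by (unfold v; ring).
    rewrite Hexc by lra.
    apply Rplus_le_compat_l. apply Rle_div_l; [nra|].
    assert (Hvv : 0 <= v * v <= 1) by nra.
    assert (v * v * (3 * s ^ 2 + 2 * v) <= 1 * (3 * s ^ 2 + 2 * v))
      by (apply Rmult_le_compat_r; lra).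
    nra. }
  assert (HfN : 3 * s ^ 2 + 2 <= f N).
  { unfold f. rewrite HN.
    set (v := IZR E0 + IZR (up s) - s ^ 2).
    assert (Hv : s <= v <= s + 2) by (unfold v; lra).
    replace (IZR E0 + IZR (up s)) with (s ^ 2 + v) by (unfold v; ring).
    rewrite Hexc by lra.
    apply Rplus_le_compat_l. apply Rle_div_r; [nra|].
    assert (Hvv : s ^ 2 <= v * v) by nra.
    assert (Hu : s ^ 2 + v <= 11 / 10 * s ^ 2) by lra.
    nra. }
  destruct (discrete_ivt f (IZR c) N) as (n & Hn & Hf1 & Hf2); [lra|lra|].
  assert (HnN : INR (S n) <= IZR (up s)) by (rewrite <- HN; apply le_INR; lia).
  rewrite S_INR in HnN. pose proof (pos_INR n).
  (* The right end of the crossing step is taken as [E], and [a = c - 2 E] undoes the term [2 e] of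
     [h]. *)
  exists (E0 + Z.of_nat (S n))%Z, (c - 2 * (E0 + Z.of_nat (S n)))%Z.
  assert (HE : IZR (E0 + Z.of_nat (S n)) = IZR E0 + INR n + 1).
  { rewrite plus_IZR, <- INR_IZR_INZ, S_INR. ring. }
  rewrite minus_IZR, mult_IZR, HE.
  split; [lra|].
  unfold f in Hf1, Hf2. rewrite S_INR, <- Rplus_assoc in Hf2.
  pose proof (Hinc (IZR E0 + INR n) ltac:(lra) ltac:(lra)) as Hi.
  unfold h in Hf1, Hf2, Hi.
  assert (0 < 7 / s) by (apply Rdiv_lt_0_compat; lra).
  apply Rabs_le. lra.
Qed.

(** Divisibility of the quadratic by [q = 3 ^ k] makes [D] an integer; [q (D - y / E)] is then
    [10 + r] plus the errors of a Taylor expansion at [E0], bounded because [u <= q] and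
    [q^2 <= 2 s]. *)
Lemma multiple_slightly_above (s y : R) (k : nat) :
  100 <= s -> s ^ 6 = 3 ^ k * y -> (3 ^ k) ^ 2 <= 2 * s ->
  exists E D : Z, s ^ 2 <= IZR E <= 2 * s ^ 2 /\
    2 <= 3 ^ k * (IZR D - y / IZR E) <= 21.
Proof.
  intros Hs Hy Hq2.
  assert (Hq1 : 1 <= 3 ^ k) by (apply pow_R1_Rle; lra).
  destruct (flat_point_with_integral_slope s Hs) as (E0 & a & HE0 & Ha).
  set (q := 3 ^ k) in *.
  destruct (archimed (s ^ 6 / IZR E0)) as [A1 A2].
  set (m := up (s ^ 6 / IZR E0)) in *.
  (* The offset 10 outweighs [b1 * u >= - (21 / 20)], the only error term that can be negative. *)
  destruct (quadratic_root_mod_3pow a (m + 10) k) as (r & t & Hr & Ht & [d Hd]).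
  assert (HqZ : IZR (3 ^ Z.of_nat k) = q) by (unfold q; rewrite pow_IZR; reflexivity).
  assert (HtR : 0 <= IZR t <= q).
  { rewrite <- HqZ. split; apply IZR_le; lia. }
  assert (HrR : 0 <= IZR r <= 2) by (split; apply IZR_le; lia).
  assert (HdR : IZR d * q = IZR t * IZR t - IZR a * IZR t + (IZR m + 10) + IZR r).
  { rewrite <- HqZ, <- mult_IZR, <- Hd. rewrite !plus_IZR, minus_IZR, !mult_IZR. ring. }
  clearbody q. clear Hd HqZ Ht Hr.
  set (e := IZR E0) in *. set (u := IZR t) in *.
  assert (Hqs : q <= 15 / 100 * s) by nra.
  assert (Hss : 100 * s <= s ^ 2) by nra.
  assert (He : 0 < e) by lra.
  exists (E0 + t)%Z, d. rewrite plus_IZR. fold e u.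
  split; [lra|].
  replace (q * (IZR d - y / (e + u))) with (IZR d * q - (q * y) / (e + u)) by (field; lra).
  rewrite <- Hy, HdR.
  (* Exact expansion of [s^6 / (e + u)]: its slope is compared with [a], its second-order
     coefficient with 1. *)
  assert (Hid : u * u - IZR a * u + (IZR m + 10) + IZR r - s ^ 6 / (e + u) =
            10 + IZR r + (IZR m - s ^ 6 / e) + (s ^ 6 / (e * e) - IZR a) * u
            + (1 - s ^ 6 / (e * e * e)) * (u * u)
            + s ^ 6 / (e * e * e) * (u * u * u) / (e + u)).
  { field. lra. }
  rewrite Hid.
  apply Rabs_le_between in Ha.
  set (b1 := s ^ 6 / (e * e) - IZR a) in *.
  set (b2 := s ^ 6 / (e * e * e)) in *.
  assert (He3 : 0 < e * e * e) by (repeat apply Rmult_lt_0_compat; lra).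
  assert (Hee : s ^ 2 * s ^ 2 <= e * e) by (apply Rmult_le_compat; lra).
  (* With [e = s^2 + v], [s^6 / e^3 >= 1 - 3 v / e] and [v / e <= 31 / (30 s)]; against [u^2 <= 2 s]
     this costs only [O(1)]. *)
  assert (Hb2 : 1 - 31 / 10 / s <= b2 <= 1).
  { unfold b2. split.
    - apply Rle_div_r; [exact He3|].
      set (v := e - s ^ 2).
      assert (Hv : 0 <= v <= s + 2) by (unfold v; lra).
      replace e with (s ^ 2 + v) by (unfold v; ring).
      assert (Hz : 0 < s ^ 2 + v) by lra.
      set (z := s ^ 2 + v) in *.
      assert (Hzs : s ^ 2 <= z /\ v <= z) by (unfold z; lra).
      replace (s ^ 6) with ((z - v) * (z - v) * (z - v)) by (unfold z; ring).
      assert (Hvz : v <= 31 / 30 / s * z).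
      { apply Rle_trans with (31 / 30 / s * s ^ 2).
        - replace (31 / 30 / s * s ^ 2) with (31 / 30 * s) by (field; lra). lra.
        - apply Rmult_le_compat_l; [|lra].
          apply Rdiv_le_0_compat; lra. }
      replace (31 / 10 / s) with (3 * (31 / 30 / s)) by (field; lra).
      set (w := 31 / 30 / s) in *.
      assert (Hz2 : 0 <= z * z) by nra.
      assert (v * (z * z) <= w * z * (z * z)) by (apply Rmult_le_compat_r; lra).
      assert (0 <= v * v * (3 * z - v)).
      { apply Rmult_le_pos; [nra|]. lra. }
      nra.
    - apply Rle_div_l; [exact He3|]. rewrite Rmult_1_l.
      replace (s ^ 6) with (s ^ 2 * s ^ 2 * s ^ 2) by ring.
      apply Rmult_le_compat; first [exact Hee | lra | apply Rmult_le_pos; lra]. }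
  assert (Hs7 : 7 / s * q <= 21 / 20).
  { replace (7 / s * q) with (7 * q / s) by (field; lra). apply Rle_div_l; lra. }
  assert (Hs0 : 0 <= 7 / s) by (apply Rdiv_le_0_compat; lra).
  assert (T1 : - (21 / 20) <= b1 * u <= 21 / 20) by (split; nra).
  assert (Huu : 0 <= u * u <= 2 * s) by (split; nra).
  assert (T2 : 0 <= (1 - b2) * (u * u) <= 62 / 10).
  { split; [apply Rmult_le_pos; lra|].
    apply Rle_trans with (31 / 10 / s * (2 * s)).
    - apply Rmult_le_compat; lra.
    - right. field. lra. }
  assert (Hb20 : 0 <= b2).
  { unfold b2. apply Rdiv_le_0_compat; [apply pow_le; lra|exact He3]. }
  assert (T3 : 0 <= b2 * (u * u * u) / (e + u) <= 3 / 10).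
  { assert (Hu3 : 0 <= u * u * u <= 2 * s * (15 / 100 * s)).
    { split; [repeat apply Rmult_le_pos; lra|]. apply Rmult_le_compat; lra. }
    split.
    - apply Rdiv_le_0_compat; [apply Rmult_le_pos; lra|lra].
    - apply Rle_div_l; [lra|].
      apply Rle_trans with (1 * (u * u * u)); [apply Rmult_le_compat_r; lra|]. nra. }
  lra.
Qed.

(** * The exponent 1/2 at [theta = 7/22] *)

Lemma pow3_near (W : R) : 1 < W -> exists k : nat, 3 ^ k < W <= 3 * 3 ^ k.
Proof.
  intros HW.
  destruct (INR_unbounded W) as [N HN].
  assert (HN3 : INR N <= 3 ^ N).
  { clear HN. induction N as [|N IH]; [simpl; lra|].
    rewrite S_INR. simpl pow. pose proof (pow_R1_Rle 3 N ltac:(lra)). lra. }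
  destruct (discrete_ivt (fun n => 3 ^ n) W N) as (k & _ & Hk); simpl; [lra|lra|].
  exists k. exact Hk.
Qed.

Lemma pow_le_reg (a b : R) (n : nat) : 0 <= b -> a ^ S n <= b ^ S n -> a <= b.
Proof.
  intros Hb H. destruct (Rle_or_lt a b) as [|Hlt]; [assumption|exfalso].
  assert (b ^ n <= a ^ n) by (apply pow_incr; lra).
  assert (0 < a ^ n) by (apply pow_lt; lra).
  simpl in H. nra.
Qed.

(** In powers of [W]: [E] has size 4, [D] size 7, [E D - y] size 3, and [j] size at most 3. So [E j]
    and [D] stay within [O(W^7)], and the greedy remainder [2 j + 1] times [E^2] within [O(W^11)],
    the square root of [x]. *)
Lemma admissible_7_22 : admissible (7 / 22) (1 / 2).
Proof.
  replace (7 / 22) with (INR 7 / INR 22) by (simpl; field).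
  replace (1 / 2) with (INR 11 / INR 22) by (simpl; field).
  apply admissible_of_quadruples with (K := 1000) (W0 := 1000); [lia|lia|lra|].
  intros W HW.
  destruct (pow3_near W ltac:(lra)) as (k & Hq1 & Hq2).
  assert (Hq0 : 1 <= 3 ^ k) by (apply pow_R1_Rle; lra).
  set (y := W ^ 11).
  assert (Hy : 0 < y) by (apply pow_lt; lra).
  set (s := Rpower (3 ^ k * y) (/ INR 6)).
  assert (Hs0 : 0 < s) by apply exp_pos.
  assert (Hs6 : s ^ 6 = 3 ^ k * y).
  { unfold s. rewrite Rpower_root_pow by (lia || nra).
    unfold Rdiv. rewrite Rinv_r by (simpl; lra). apply Rpower_1. nra. }
  assert (HWy : W ^ 12 = W * y) by (unfold y; ring).
  assert (HsW : s <= W ^ 2).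
  { apply (pow_le_reg s (W ^ 2) 5); [nra|].
    replace ((W ^ 2) ^ 6) with (W ^ 12) by ring. nra. }
  assert (HWs : 8 / 10 * W ^ 2 <= s).
  { apply (pow_le_reg (8 / 10 * W ^ 2) s 5); [lra|].
    replace ((8 / 10 * W ^ 2) ^ 6) with ((8 / 10) ^ 6 * W ^ 12) by ring.
    rewrite Hs6, HWy. simpl pow. nra. }
  destruct (multiple_slightly_above s y k) as (E & D & HE & HD); [nra|exact Hs6|nra|].
  set (q := 3 ^ k) in *.
  set (e := IZR E) in *. set (d := IZR D) in *.
  set (A := W ^ 3). set (B := W ^ 4).
  assert (HyAB : y = A * B * B) by (unfold y, A, B; ring).
  assert (HA : 1000 * W <= A) by (unfold A; nra).
  assert (HB : B = A * W) by (unfold A, B; ring).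
  assert (HeB : 64 / 100 * B <= e <= 2 * B).
  { assert (64 / 100 * B <= s ^ 2) by (replace B with (W ^ 2 * W ^ 2) by (unfold B; ring); nra).
    assert (s ^ 2 <= B) by (replace B with (W ^ 2 * W ^ 2) by (unfold B; ring); nra).
    lra. }
  assert (Hye : q * y <= e * e * e).
  { rewrite <- Hs6. replace (s ^ 6) with (s ^ 2 * s ^ 2 * s ^ 2) by ring.
    assert (0 <= s ^ 2) by nra.
    apply Rmult_le_compat; [apply Rmult_le_pos; lra|lra| |lra].
    apply Rmult_le_compat; lra. }
  assert (HW22 : W ^ 22 = y * y) by (unfold y; ring).
  assert (HW7 : W ^ 7 = A * B) by (unfold A, B; ring).
  assert (HEe : IZR E = e) by reflexivity.
  assert (HDd : IZR D = d) by reflexivity.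
  clearbody q. clearbody e d s y A B. clear HWy HsW HWs Hs6 Hs0.
  assert (HB0 : 1000 * A <= B) by (rewrite HB; nra).
  (* The natural unit for [e * d - y]: the bounds 2 and 21 on [q (d - y / e)] become [2 p] and
     [21 p]. *)
  set (p := e / q).
  assert (Hep : e = p * q) by (unfold p; field; lra).
  assert (Hp : 64 / 100 * A <= p <= 6 * A).
  { split; apply (Rmult_le_reg_r q); try rewrite <- Hep; try lra.
    - assert (64 / 100 * A * q <= 64 / 100 * A * W) by (apply Rmult_le_compat_l; lra). lra.
    - assert (2 * A * W <= 2 * A * (3 * q)) by (apply Rmult_le_compat_l; lra). lra. }
  set (del := e * d - y).
  assert (Hdel : 2 * p <= del <= 21 * p).
  { assert (Hx : del = p * (q * (d - y / e))) by (unfold del, p; field; lra).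
    rewrite Hx. split; nra. }
  assert (HAB : 1000 * 1000 * A <= A * B) by nra.
  assert (HyB : 1000 * B <= A * B) by nra.
  assert (HyA : A * B * 1000 <= y) by (rewrite HyAB; nra).
  assert (Hdely : 0 <= del <= y / 100) by lra.
  assert (Hyp : y <= p * (e * e)).
  { apply (Rmult_le_reg_l q); [lra|]. replace (q * (p * (e * e))) with (p * q * (e * e)) by ring.
    rewrite <- Hep. lra. }
  assert (Hde : d * e = y + del) by (unfold del; ring).
  assert (Hd2 : d * d <= 11 / 10 * (y * p)).
  { apply (Rmult_le_reg_r (e * e)); [nra|].
    replace (d * d * (e * e)) with ((d * e) * (d * e)) by ring. rewrite Hde.
    apply Rle_trans with (11 / 10 * (y * y)); [nra|].
    assert (y * y <= y * (p * (e * e))) by (apply Rmult_le_compat_l; lra). lra. }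
  assert (Hee : e * e <= y * p).
  { rewrite Hep at 1. assert (q * e <= y); [|nra].
    apply Rle_trans with (W * (2 * B)); nra. }
  (* The excess over [y^2] left after [i = 1]. It is at least [e^2], since [2 y del >= 4 y p]
     outweighs [d^2 <= 11/10 y p] and [e^2 <= y p]; this leaves room for [j >= 1]. *)
  set (P := del * (2 * y + del) - d * d).
  assert (HP1 : e * e <= P) by (unfold P; nra).
  assert (HP2 : P <= 255 * (A * y)) by (unfold P; nra).
  assert (HPe : P = d * d * (e * e - 1) - y * y).
  { unfold P, del. ring. }
  assert (HBB : 1000 * 1000 <= B * B) by (apply Rmult_le_compat; lra).
  assert (He1 : 4 / 10 * (B * B) <= e * e - 1 <= 4 * (B * B)).
  { assert (64 / 100 * B * (64 / 100 * B) <= e * e) by (apply Rmult_le_compat; lra).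
    assert (e * e <= 2 * B * (2 * B)) by (apply Rmult_le_compat; lra).
    lra. }
  assert (Hee1 : 0 < e * e - 1) by lra.
  set (rho := P / (e * e - 1)).
  assert (Hrho : P = rho * (e * e - 1)) by (unfold rho; field; lra).
  assert (Hrho1 : 1 <= rho) by (unfold rho; apply Rle_div_r; lra).
  assert (Hrho2 : rho <= 640 * (A * A)).
  { unfold rho. apply Rle_div_l; [lra|].
    assert (640 * (A * A) * (4 / 10 * (B * B)) <= 640 * (A * A) * (e * e - 1))
      by (apply Rmult_le_compat_l; nra).
    assert (0 <= A * A * (B * B)) by (apply Rmult_le_pos; nra).
    replace (A * y) with (A * A * (B * B)) in HP2 by (rewrite HyAB; ring). lra. }
  destruct (floor_sqrt rho Hrho1) as (j & Hj & Hj1 & Hj2).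
  assert (HjR : 1 <= IZR j) by (apply IZR_le; lia).
  assert (HjA : IZR j <= 26 * A).
  { destruct (Rle_or_lt (IZR j) (26 * A)) as [|Hlt]; [assumption|exfalso].
    assert (26 * A * (26 * A) <= IZR j * IZR j) by (apply Rmult_le_compat; lra).
    assert (0 < A * A) by (apply Rmult_lt_0_compat; lra). lra. }
  assert (Hd : 0 < d) by (apply (Rmult_lt_reg_r e); lra).
  assert (HdAB : d <= 2 * (A * B)).
  { apply (Rmult_le_reg_r e); [lra|]. rewrite Hde.
    assert (A * B * (64 / 100 * B) <= A * B * e) by (apply Rmult_le_compat_l; lra). lra. }
  exists E, D, 1%Z, j.
  split. { assert (1 < E)%Z by (apply lt_IZR; lra). lia. }
  split.
  { split; [lia|]. apply lt_IZR. rewrite HDd.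
    assert (Hyy : 0 < y * y) by (apply Rmult_lt_0_compat; lra).
    assert (Hrd : rho < d * d) by (apply (Rmult_lt_reg_r (e * e - 1)); lra).
    destruct (Rlt_or_le (IZR j) d) as [|Hdj]; [assumption|exfalso].
    assert (d * d <= IZR j * IZR j) by (apply Rmult_le_compat; lra). lra. }
  rewrite mult_IZR, plus_IZR, !minus_IZR, !mult_IZR, HEe, HDd.
  rewrite HW22, HW7.
  split.
  - replace ((e * e - 1 * 1) * (d * d - IZR j * IZR j) - y * y)
      with ((rho - IZR j * IZR j) * (e * e - 1)) by lra.
    rewrite Rabs_pos_eq by (apply Rmult_le_pos; lra).
    (* [rho - j^2] is below [2 j + 1 <= 53 A], and [A B^2 = y]. *)
    apply Rle_trans with (53 * A * (4 * (B * B))); [apply Rmult_le_compat; lra|]. lra.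
  - assert (e * IZR j <= 2 * B * (26 * A)) by (apply Rmult_le_compat; lra).
    lra.
Qed.

(** * The exponents 5/8 at [theta = 1/4] and 17/32 at [theta = 5/16] *)

(** With [x = W^8], [E D] exceeds [W^4] by [O(W)], so its square exceeds [x] by [O(W^5)]; taking
    [i = j = 1] changes this by only [O(W^4)]. *)
Lemma admissible_1_4 : admissible (1 / 4) (5 / 8).
Proof.
  replace (1 / 4) with (INR 2 / INR 8) by (simpl; field).
  replace (5 / 8) with (INR 5 / INR 8) by (simpl; field).
  apply admissible_of_quadruples with (K := 100) (W0 := 100); [lia|lia|lra|].
  intros W HW.
  destruct (product_near_fourth_power W HW) as (E & D & HE & HD & HP).
  exists E, D, 1%Z, 1%Z.
  assert (HU : 100 * W <= W ^ 2) by nra.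
  split. { assert (1 < E)%Z by (apply lt_IZR; lra). lia. }
  split. { assert (1 < D)%Z by (apply lt_IZR; lra). lia. }
  rewrite mult_IZR, plus_IZR, !minus_IZR, !mult_IZR.
  set (e := IZR E) in *. set (d := IZR D) in *.
  split; [|lra].
  set (del := e * d - W ^ 4) in *.
  assert (H4 : 1000000 * W <= W ^ 4) by (replace (W ^ 4) with (W ^ 2 * W ^ 2) by ring; nra).
  replace ((e * e - 1 * 1) * (d * d - 1 * 1) - W ^ 8)
    with (del * (2 * W ^ 4 + del) + 1 - e * e - d * d) by (unfold del; ring).
  assert (0 <= e * e <= 2 * W ^ 4) by (replace (W ^ 4) with (W ^ 2 * W ^ 2) by ring; split; nra).
  assert (0 <= d * d <= 2 * W ^ 4) by (replace (W ^ 4) with (W ^ 2 * W ^ 2) by ring; split; nra).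
  assert (0 <= del * (2 * W ^ 4 + del) <= 18 * W * (3 * W ^ 4)).
  { split; [apply Rmult_le_pos; lra|]. apply Rmult_le_compat; lra. }
  assert (100 * W ^ 4 <= W ^ 5) by (replace (W ^ 5) with (W * W ^ 4) by ring; nra).
  replace (18 * W * (3 * W ^ 4)) with (54 * W ^ 5) in * by ring.
  apply Rabs_le. lra.
Qed.

(** With [x = W^32], the excess of [(E D)^2] is [O(W^20)]. Choosing [i = O(W^2)] reduces it to
    [O(W^18)], and then [j = O(W)] to [O(W^17)]. *)
Lemma admissible_5_16 : admissible (5 / 16) (17 / 32).
Proof.
  replace (5 / 16) with (INR 10 / INR 32) by (simpl; field).
  replace (17 / 32) with (INR 17 / INR 32) by (simpl; field).
  apply admissible_of_quadruples with (K := 100) (W0 := 100); [lia|lia|lra|].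
  intros W HW.
  assert (HW2 : 100 * W <= W ^ 2) by nra.
  assert (HW4 : 10000 * W ^ 2 <= W ^ 4) by (replace (W ^ 4) with (W ^ 2 * W ^ 2) by ring; nra).
  assert (HW8 : 10000 * W ^ 4 <= W ^ 8) by (replace (W ^ 8) with (W ^ 4 * W ^ 4) by ring; nra).
  assert (HW16 : 10000 * W ^ 8 <= W ^ 16) by (replace (W ^ 16) with (W ^ 8 * W ^ 8) by ring; nra).
  destruct (product_near_fourth_power (W ^ 4)) as (E & D & HE & HD & HP); [lra|].
  replace ((W ^ 4) ^ 2) with (W ^ 8) in * by ring.
  replace ((W ^ 4) ^ 4) with (W ^ 16) in * by ring.
  set (del := IZR E * IZR D - W ^ 16) in *.
  set (rho := IZR E * IZR E * (IZR D * IZR D) - W ^ 16 * W ^ 16).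
  assert (Hrho : rho = del * (2 * W ^ 16 + del)) by (unfold rho, del; ring).
  assert (Hee : 81 / 100 * W ^ 16 <= IZR E * IZR E <= 121 / 100 * W ^ 16)
    by (replace (W ^ 16) with (W ^ 8 * W ^ 8) by ring; split; nra).
  assert (Hdd : 81 / 100 * W ^ 16 <= IZR D * IZR D <= 121 / 100 * W ^ 16)
    by (replace (W ^ 16) with (W ^ 8 * W ^ 8) by ring; split; nra).
  assert (Hr1 : 5 * (IZR D * IZR D) <= rho) by (rewrite Hrho; nra).
  assert (Hr2 : rho <= 48 * W ^ 4 * (IZR D * IZR D)).
  { rewrite Hrho. apply Rle_trans with (18 * W ^ 4 * (21 / 10 * W ^ 16)).
    - apply Rmult_le_compat; lra.
    - assert (W ^ 4 * (81 / 100 * W ^ 16) <= W ^ 4 * (IZR D * IZR D))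
        by (apply Rmult_le_compat_l; lra).
      assert (0 <= W ^ 4 * W ^ 16) by (apply Rmult_le_pos; lra). lra. }
  assert (HW32 : W ^ 32 = W ^ 16 * W ^ 16) by ring.
  assert (HW17 : W ^ 17 = W * W ^ 16) by ring.
  assert (HW10 : W ^ 10 = W ^ 2 * W ^ 8) by ring.
  assert (HW22 : W ^ 4 = W ^ 2 * W ^ 2) by ring.
  assert (HWW : W ^ 2 = W * W) by ring.
  assert (HEe : rho = IZR E * IZR E * (IZR D * IZR D) - W ^ 16 * W ^ 16) by reflexivity.
  clearbody rho del.
  remember (IZR E) as e eqn:HeE. remember (IZR D) as d eqn:HdD.
  assert (Hdpos : 0 < d * d) by lra.
  (* Holding back 4 leaves a remainder of at least [4 d^2], which exceeds [f] below, so that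
     [j >= 1] is possible. *)
  destruct (floor_sqrt (rho / (d * d) - 4)) as (i & Hi & Hi1 & Hi2).
  { assert (Hx : rho = rho / (d * d) * (d * d)) by (field; nra). nra. }
  assert (HiR : 1 <= IZR i) by (apply IZR_le; lia).
  remember (IZR i) as a eqn:Hai.
  set (rho' := rho - a * a * (d * d)).
  assert (Hx : rho' = (rho / (d * d) - a * a) * (d * d)) by (unfold rho'; field; nra).
  set (c := rho / (d * d)) in *.
  assert (Hc : c <= 48 * W ^ 4).
  { apply (Rmult_le_reg_r (d * d)); [lra|]. unfold c. unfold Rdiv.
    rewrite Rmult_assoc, Rinv_l, Rmult_1_r by lra. exact Hr2. }
  assert (Ha : a <= 7 * W ^ 2).
  { destruct (Rle_or_lt a (7 * W ^ 2)) as [|Hlt]; [assumption|exfalso].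
    assert (7 * W ^ 2 * (7 * W ^ 2) <= a * a) by (apply Rmult_le_compat; lra). lra. }
  assert (Hrho'1 : 4 * (d * d) <= rho') by (rewrite Hx; apply Rmult_le_compat_r; lra).
  assert (Hrho'2 : rho' <= (2 * a + 5) * (d * d)) by (rewrite Hx; apply Rmult_le_compat_r; lra).
  (* The remainder after [i] is [rho' = f d^2 - x], and choosing [j] subtracts [j^2 f] from it. *)
  set (f := e * e - a * a).
  assert (Hf : 80 / 100 * W ^ 16 <= f <= 121 / 100 * W ^ 16).
  { assert (0 <= a * a <= 49 * W ^ 4) by nra. unfold f. lra. }
  assert (Hf0 : 0 < f) by lra.
  set (r := rho' / f).
  assert (Hr : rho' = r * f) by (unfold r; field; lra).
  destruct (floor_sqrt r) as (j & Hj & Hj1 & Hj2).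
  { apply (Rmult_le_reg_r f); [lra|]. lra. }
  assert (HjR : 1 <= IZR j) by (apply IZR_le; lia).
  remember (IZR j) as b eqn:Hbj.
  assert (Hr25 : r <= 25 * W ^ 2).
  { apply (Rmult_le_reg_r f); [lra|]. rewrite <- Hr.
    apply Rle_trans with (145 / 10 * W ^ 2 * (121 / 100 * W ^ 16)).
    - apply Rle_trans with (1 := Hrho'2). apply Rmult_le_compat; lra.
    - apply Rle_trans with (25 * W ^ 2 * (80 / 100 * W ^ 16)).
      + assert (0 <= W ^ 2 * W ^ 16) by (apply Rmult_le_pos; lra). lra.
      + apply Rmult_le_compat_l; lra. }
  assert (Hb : b <= 5 * W).
  { destruct (Rle_or_lt b (5 * W)) as [|Hlt]; [assumption|exfalso].
    assert (5 * W * (5 * W) < b * b) by (apply Rmult_le_0_lt_compat; lra). lra. }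
  exists E, D, i, j.
  split. { split; [lia|]. apply lt_IZR. lra. }
  split. { split; [lia|]. apply lt_IZR. lra. }
  rewrite mult_IZR, plus_IZR, !minus_IZR, !mult_IZR, <- HeE, <- HdD, <- Hai, <- Hbj.
  rewrite HW32, HW17, HW10.
  split.
  - replace ((e * e - a * a) * (d * d - b * b) - W ^ 16 * W ^ 16) with ((r - b * b) * f)
      by (unfold rho', f in *; lra).
    rewrite Rabs_pos_eq by (apply Rmult_le_pos; lra).
    apply Rle_trans with (11 * W * (121 / 100 * W ^ 16)).
    + apply Rmult_le_compat; lra.
    + assert (0 <= W * W ^ 16) by (apply Rmult_le_pos; lra). lra.
  - assert (e * b <= 11 / 10 * W ^ 8 * (5 * W)) by (apply Rmult_le_compat; lra).
    assert (d * a <= 11 / 10 * W ^ 8 * (7 * W ^ 2)) by (apply Rmult_le_compat; lra).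
    assert (W ^ 8 * (100 * W) <= W ^ 8 * W ^ 2) by (apply Rmult_le_compat_l; lra).
    assert (0 <= W ^ 8 * W) by (apply Rmult_le_pos; lra).
    lra.
Qed.

(** * The five bounds on [g] *)

Theorem theorem3 :
  Rbar_le (g (1/4)) (Finite (5/8)) /\
  (forall theta : R, 5/16 <= theta <= 1/2 -> Rbar_le (g theta) (Finite (9/16))) /\
  (forall theta : R, 5/16 <= theta <= 1/2 -> Rbar_le (g theta) (Finite (17/32))) /\
  (forall theta : R, 1/3 < theta <= 1/2 -> Rbar_le (g theta) (Finite (1/2))) /\
  (forall theta : R, 743/2306 < theta <= 1/2 -> Rbar_le (g theta) (Finite (1/2))).
Proof.
  assert (H516 : forall theta, 5/16 <= theta <= 1/2 -> Rbar_le (g theta) (Finite (17/32))).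
  { intros theta Ht. apply g_le. apply admissible_mono with (5/16); [lra|].
    exact admissible_5_16. }
  assert (H722 : forall theta, 7/22 <= theta <= 1/2 -> Rbar_le (g theta) (Finite (1/2))).
  { intros theta Ht. apply g_le. apply admissible_mono with (7/22); [lra|].
    exact admissible_7_22. }
  split; [exact (g_le _ _ admissible_1_4)|].
  split.
  { intros theta Ht. apply Rbar_le_trans with (Finite (17/32)); [now apply H516|simpl; lra]. }
  split; [exact H516|].
  (* Both ranges lie above 7/22, as [7/22 < 743/2306 < 1/3]. *)
  split; intros theta Ht; apply H722; lra.
Qed.
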